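(* Let $\Phi$ be a finite crystallographic root system or an untwisted affine root system. Any maximal chain in the extended weak order on $\Phi$ is the set of initial segments of a unique total ordering on the positive roots $\Phi^+$.
   Context: Root systems are (symmetrizable, crystallographic, real, reduced) root systems with base $\Pi$ and positive roots $\Phi^+=\Phi\cap\mathrm{Span}_+\Pi$ ($\mathrm{Span}_+$ = nonnegative linear combinations). Untwisted affine root systems are affinizations $\{\alpha+k\delta:\alpha\in\Phi_0,k\in\mathbb{Z}\}$ of finite irreducible root systems $\Phi_0$, imaginary roots excluded. A subset $B\subseteq\Phi^+$ is biclosed if for all $\alpha,\beta\in\Phi^+$ and $\gamma\in\mathrm{Span}_+(\alpha,\beta)\cap\Phi^+$: $\alpha,\beta\in B\Rightarrow\gamma\in B$ and $\alpha,\beta\notin B\Rightarrow\gamma\notin B$. The extended weak order is the poset of biclosed subsets of $\Phi^+$ ordered by inclusion; a maximal chain is a totally ordered family of biclosed sets that is maximal with this property. *)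

(* Defs.v *)
From HB Require Import structures.
From mathcomp Require Import all_boot all_order all_algebra.
From mathcomp Require Import boolp classical_sets cardinality reals.
Set Implicit Arguments. Unset Strict Implicit. Unset Printing Implicit Defensive.
Import Order.TTheory GRing.Theory Num.Theory.
Local Open Scope ring_scope.
Local Open Scope classical_set_scope.

Definition spanp {R : numDomainType} {V : lmodType R} (S : set V) : set V :=
  [set v | exists s : seq (R * V),
     (forall p, p \in s -> 0 <= p.1 /\ S p.2) /\
     v = \sum_(p <- s) p.1 *: p.2].

Definition span2p {R : numDomainType} {V : lmodType R} (a b : V) : set V :=
  [set v | exists c d : R, 0 <= c /\ 0 <= d /\ v = c *: a + d *: b].

Definition lin_indep {R : numDomainType} {V : lmodType R} (S : set V) : Prop :=
  forall (s : seq V) (c : V -> R), uniq s -> (forall x, x \in s -> S x) ->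
    \sum_(x <- s) c x *: x = 0 -> forall x, x \in s -> c x = 0.

Definition biclosed {R : numDomainType} {V : lmodType R} (P B : set V) : Prop :=
  B `<=` P /\
  forall a b g, P a -> P b -> P g -> span2p a b g ->
    (B a -> B b -> B g) /\ (~ B a -> ~ B b -> ~ B g).

(* A chain in the extended weak order (poset of biclosed subsets of P under
   inclusion): a totally ordered family of biclosed sets. *)
Definition biclosed_chain {R : numDomainType} {V : lmodType R}
    (P : set V) (C : set (set V)) : Prop :=
  (forall B, C B -> biclosed P B) /\
  (forall B1 B2, C B1 -> C B2 -> B1 `<=` B2 \/ B2 `<=` B1).

Definition maximal_biclosed_chain {R : numDomainType} {V : lmodType R}
    (P : set V) (C : set (set V)) : Prop :=
  biclosed_chain P C /\
  (forall C', biclosed_chain P C' -> C `<=` C' -> C' = C).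

Definition total_order_on {V : Type} (P : set V) (le : V -> V -> Prop) : Prop :=
  [/\ (forall x, P x -> le x x),
      (forall x y, P x -> P y -> le x y -> le y x -> x = y),
      (forall x y z, P x -> P y -> P z -> le x y -> le y z -> le x z) &
      (forall x y, P x -> P y -> le x y \/ le y x)].

Definition initial_segment {V : Type} (P : set V) (le : V -> V -> Prop)
    (B : set V) : Prop :=
  B `<=` P /\ (forall x y, P x -> B y -> le x y -> B x).

Definition chain_is_initial_segments_of_unique_order {V : Type}
    (P : set V) (C : set (set V)) : Prop :=
  exists le : V -> V -> Prop,
    [/\ total_order_on P le,
        C = [set B | initial_segment P le B] &
        forall le' : V -> V -> Prop, total_order_on P le' ->
          C = [set B | initial_segment P le' B] ->
          forall x y, P x -> P y -> (le' x y <-> le x y)].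

Definition dotv {R : realType} {n : nat} (u v : 'rV[R]_n) : R := (u *m v^T) 0 0.

Definition reflv {R : realType} {n : nat} (a b : 'rV[R]_n) : 'rV[R]_n :=
  b - (2 * dotv b a / dotv a a) *: a.

Definition finite_root_system {R : realType} {n : nat} (Phi : set 'rV[R]_n) : Prop :=
  [/\ finite_set Phi,
      ~ Phi 0,
      (forall a b, Phi a -> Phi b -> Phi (reflv a b)),
      (forall a b, Phi a -> Phi b -> exists z : int, 2 * dotv b a / dotv a a = z%:~R) &
      (forall a (c : R), Phi a -> Phi (c *: a) -> c = 1 \/ c = -1)].

(* Pi is a base of Phi: linearly independent set of roots such that every
   root is a nonnegative or nonpositive integer combination of Pi
   (a nonnegative integer combination = sum of a finite list of elements
   of Pi, repetitions allowed). *)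
Definition root_base {R : realType} {n : nat} (Phi Pi : set 'rV[R]_n) : Prop :=
  [/\ Pi `<=` Phi,
      lin_indep Pi &
      forall a, Phi a -> exists s : seq 'rV[R]_n,
        (forall x, x \in s -> Pi x) /\
        (a = \sum_(x <- s) x \/ a = - \sum_(x <- s) x)].

Definition irreducible_rs {R : realType} {n : nat} (Phi : set 'rV[R]_n) : Prop :=
  (exists a, Phi a) /\
  forall A B, A `|` B = Phi -> A `&` B = set0 ->
    (forall a b, A a -> B b -> dotv a b = 0) -> A = set0 \/ B = set0.

Definition pos_roots {R : numDomainType} {V : lmodType R} (Phi Pi : set V) : set V :=
  Phi `&` spanp Pi.

Definition highest_root {R : realType} {n : nat} (Phi0 Pi0 : set 'rV[R]_n)
    (theta : 'rV[R]_n) : Prop :=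
  Phi0 theta /\ forall b, Phi0 b -> spanp Pi0 (theta - b).

(* Ambient space R^(n+1) = R^n x R; the vector row_mx a (k%:M) stands for
   a + k delta, with delta = row_mx 0 1 (last coordinate).
   Real roots: {a + k delta | a in Phi0, k in Z} (imaginary roots excluded).
   Affine base: Pi0 ∪ {delta - theta}, theta the highest root of Phi0. *)

Definition affv {R : realType} {n : nat} (a : 'rV[R]_n) (k : R) : 'rV[R]_(n + 1) :=
  row_mx a (k%:M).

Definition affine_roots {R : realType} {n : nat} (Phi0 : set 'rV[R]_n) :
    set 'rV[R]_(n + 1) :=
  [set v | exists a (k : int), Phi0 a /\ v = affv a k%:~R].

Definition affine_base {R : realType} {n : nat} (Pi0 : set 'rV[R]_n)
    (theta : 'rV[R]_n) : set 'rV[R]_(n + 1) :=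
  [set v | (exists a, Pi0 a /\ v = affv a 0) \/ v = affv (- theta) 1].

(* Main.v *)
Require Import Defs.
From HB Require Import structures.
From mathcomp Require Import all_boot all_order all_algebra.
From mathcomp Require Import boolp classical_sets cardinality reals.
From mathcomp Require Import zify ring lra.
Import Order.TTheory GRing.Theory Num.Theory.
Local Open Scope ring_scope.
Local Open Scope classical_set_scope.

(* Fix a positive system [P] of [Psi] and encode a biclosed set [B] by
   [Q = (P \ B) U -B]: biclosed sets then correspond to the subsets [Q] of [Psi] that
   are closed under cones and contain exactly one of [x], [-x] for each root. A chain is
   determined by an order as soon as no two comparable biclosed sets whose difference has
   at least two elements are consecutive, and for this it suffices that whenever
   [B1] is strictly included in [B2], a single root can be added to [B1] or removed from
   [B2] inside [B2 \ B1]. A root [b] can be flipped in [Q] when it is simple, i.e. when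
   the reflection in [b] preserves [Q \ b].

   If [Q] differs from a system with an integral height function by finitely many roots,
   then flipping simple roots one by one carries the height to [Q]; a root of [Q1 \ Q2] of
   minimal height is then simple in [Q1].

   In the affine case let [Y(Q)] be the set of finite roots [a] with [a + k delta] in [Q]
   for all large [k]. On the roots over [J = Y(Q) /\ -Y(Q)], [Q] differs finitely from
   [P], and simple roots there remain simple in [Psi] because reflections in [J] preserve
   [Y(Q)], its complement and their opposites. So [B1] can be enlarged unless [Q1] and
   [Q2] agree over [J(Q1)]; dually, [B2] can be shrunk unless they agree over the
   analogous part of [-Q2]. If both agree then [Y(Q1) = Y(Q2)], and since all other
   [delta]-strings lie entirely inside or outside [Q], also [Q1 = Q2]. *)

(** * Chains of biclosed sets *)

Lemma biclosed_bigcup {R : numDomainType} {V : lmodType R} (P : set V)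
    (S : set (set V)) :
  biclosed_chain P S -> biclosed P [set x | exists2 B, S B & B x].
Proof.
move=> [Sbi Schain]; split=> [x [B /Sbi[BP _] /BP]|a b g Pa Pb Pg abg] //.
split=> [[A SA Aa] [B SB Bb]|nSa nSb [B SB Bg]].
  have [AB|BA] := Schain _ _ SA SB.
    by exists B => //; apply: ((Sbi _ SB).2 _ _ _ Pa Pb Pg abg).1 => //; apply: AB.
  by exists A => //; apply: ((Sbi _ SA).2 _ _ _ Pa Pb Pg abg).1 => //; apply: BA.
apply: ((Sbi _ SB).2 _ _ _ Pa Pb Pg abg).2 Bg => [Ba|Bb]; [apply: nSa|apply: nSb].
- by exists B.
- by exists B.
Qed.

Lemma biclosed_compl {R : numDomainType} {V : lmodType R} (P B : set V) :
  biclosed P B -> biclosed P (P `\` B).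
Proof.
move=> [BP Bc]; split=> [x []//|a b g Pa Pb Pg abg].
have [h1 h2] := Bc _ _ _ Pa Pb Pg abg.
split=> [[_ na] [_ nb]|na nb [_ ng]]; first by split=> //; exact: h2.
by apply: ng; apply: h1; apply: contrapT => H; [apply: na | apply: nb].
Qed.

(** Complementation in [P] turns the intersection into the union of a chain. The conjunct [P x]
    makes the intersection of the empty chain equal to [P]. *)
Lemma biclosed_bigcap {R : numDomainType} {V : lmodType R} (P : set V)
    (S : set (set V)) :
  biclosed_chain P S -> biclosed P [set x | P x /\ forall B, S B -> B x].
Proof.
move=> [Sbi Schain].
pose T := [set B | B `<=` P /\ S (P `\` B)].
have Tch : biclosed_chain P T.
  have PDD B : B `<=` P -> P `\` (P `\` B) = B by move/setIidPr; rewrite setDD.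
  split=> [B [BP SB]|A B [AP SA] [BP SB]].
    by rewrite -(PDD B BP); apply: biclosed_compl; apply: Sbi.
  rewrite -(PDD A AP) -(PDD B BP).
  by have [h|h] := Schain _ _ SA SB; [right|left]; apply: setDS.
have := biclosed_compl _ _ (biclosed_bigcup _ _ Tch).
congr biclosed; apply/seteqP; split=> x /= [Px h]; split=> //.
  move=> B SB; apply: contrapT => nBx; apply: h; exists (P `\` B) => //; split=> [y []//|].
  by rewrite setDD; case: (Sbi _ SB) => /setIidPr ->.
by move=> [B [BP SB] Bx]; have [] := h _ SB.
Qed.

(** The order puts [x] before [y] when every member of [C] containing [y] contains [x]. If distinct
    [x] and [y] were not separated by [C], compare the union [Low] of the members avoiding them with
    the intersection [Up] of the members containing them: by maximality every biclosed set in
    between belongs to [C], and a one-root step there is contradictory. *)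
Lemma chain_of_one_step {R : numDomainType} {V : lmodType R} (P : set V)
    (C : set (set V)) :
  (forall B1 B2, biclosed P B1 -> biclosed P B2 -> B1 `<=` B2 -> B1 <> B2 ->
     exists x, [/\ B2 x, ~ B1 x &
       biclosed P (B1 `|` [set x]) \/ biclosed P (B2 `\` [set x])]) ->
  maximal_biclosed_chain P C -> chain_is_initial_segments_of_unique_order P C.
Proof.
move=> step [[Cbi Cchain] Cmax].
have Csub (S : set (set V)) : S `<=` C -> biclosed_chain P S.
  by move=> SC; split=> [B /SC/Cbi|A B /SC CA /SC CB] //; apply: Cchain.
have memC M : biclosed P M -> (forall B, C B -> B `<=` M \/ M `<=` B) -> C M.
  move=> Mbi Mcmp; rewrite -(Cmax (C `|` [set M])); [by right| |by move=> B; left].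
  split=> [B [/Cbi|->]|A B [CA|->] [CB|->]] //; [exact: Cchain|exact: Mcmp| |by left].
  by have [] := Mcmp _ CB; [right|left].
pose le x y := forall B, C B -> B y -> B x.
have le_total x y : P x -> P y -> le x y \/ le y x.
  move=> Px Py; have [|nxy] := EM (le x y); first by left.
  right=> B CB Bx; apply: contrapT => nBy; apply: nxy => A CA Ay.
  by have [AB|BA] := Cchain _ _ CA CB; [case: nBy; apply: AB | apply: BA].
have le_anti x y : P x -> P y -> le x y -> le y x -> x = y.
  move=> Px Py lexy leyx; apply: contrapT => xy.
  pose Low := [set z | exists2 B, C B /\ ~ B x & B z].
  pose Up := [set z | P z /\ forall B, C B /\ B x -> B z].
  have Lowbi : biclosed P Low by apply: biclosed_bigcup; apply: Csub => B [].
  have Upbi : biclosed P Up by apply: biclosed_bigcap; apply: Csub => B [].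
  have LowUp : Low `<=` Up.
    move=> z [A [CA nAx] Az]; split; first by case: (Cbi _ CA) => AP _; apply: AP.
    move=> B [CB Bx]; have [AB|BA] := Cchain _ _ CA CB; first exact: AB.
    by case: nAx; apply: BA.
  have nLx : ~ Low x by move=> [B [_ nBx] Bx].
  have nLy : ~ Low y by move=> [B [CB nBx] By]; apply/nBx/(lexy _ CB).
  have Ux : Up x by split=> // B [].
  have Uy : Up y by split=> // B [CB Bx]; apply: (leyx _ CB).
  have btwC M : biclosed P M -> Low `<=` M -> M `<=` Up -> C M.
    move=> Mbi LM MU; apply: memC => // B CB; have [Bx|nBx] := EM (B x).
      by right=> z /MU[_]; apply.
    by left=> z Bz; apply: LM; exists B.
  have [|z [Uz nLz zbi]] := step _ _ Lowbi Upbi LowUp; first by move=> LU; apply: nLx; rewrite LU.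
  (* Both modifications would be members of [C]. [Low] with [z] added must contain [x], hence [y],
     so that both equal [z]. [Up] without [z] either contains [y] but not [x = z], or contains [x]
     and therefore all of [Up]. *)
  case: zbi => Mbi.
    have CM : C (Low `|` [set z]).
      by apply: btwC => // t [/LowUp//|->].
    have zLz : (Low `|` [set z]) z by right.
    have Mx : (Low `|` [set z]) x.
      by apply: contrapT => nMx; apply: nLz; exists (Low `|` [set z]).
    have My := leyx _ CM Mx.
    case: Mx My => [/nLx//|xz] [/nLy//|yz].
    by apply: xy; rewrite yz.
  have CM : C (Up `\` [set z]).
    apply: btwC => // t Lt; split; first exact: LowUp.
    by move=> /= tz; apply: nLz; rewrite -tz.
  have [xz|xz] := EM (x = z).
    have [_] : (Up `\` [set z]) x.
      by apply: (lexy _ CM); split=> //= yz; apply: xy; rewrite xz yz.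
    by apply.
  by case: Uz => _ /(_ _ (conj CM (conj Ux xz)))[_]; apply.
exists le; split.
- split=> // [x Px B //|x y z _ _ _ xy yz B CB Bz].
  by apply: xy => //; apply: yz.
- apply/seteqP; split=> B; first by move=> CB; split=> [|x y Px By]; [case: (Cbi _ CB)|apply].
  move=> [BP Bini].
  pose S := [set A | C A /\ A `<=` B].
  (* For [x] in [B], the least member of [C] containing [x] consists of elements below [x], so it
     lies in [B]. *)
  have -> : B = [set x | exists2 A, S A & A x].
    apply/seteqP; split=> x; last by move=> [A [_ AB] /AB].
    move=> Bx; exists [set z | P z /\ forall A, (C A /\ A x) -> A z]; last first.
      by split; [apply: BP|move=> A []].
    split=> [|z [Pz zx]]; last by apply: (Bini _ _ Pz Bx) => A CA Ax; apply: zx.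
    apply: memC => [|A CA]; first by apply: biclosed_bigcap; apply: Csub => A [].
    have [Ax|nAx] := EM (A x); first by right=> z [_]; apply.
    left=> z Az; split; first by case: (Cbi _ CA) => AP _; apply: AP.
    by move=> D [CD Dx]; have [|DA] := Cchain _ _ CA CD; [apply|case: nAx; apply: DA].
  apply: memC => [|A CA]; first by apply: biclosed_bigcup; apply: Csub => A [].
  have [AB|nAB] := EM (A `<=` B); first by left=> x Ax; exists A.
  right=> x [D [CD DB] Dx]; have [AD|DA] := Cchain _ _ CA CD; last exact: DA.
  by case: nAB => z /AD /DB.
- move=> le' [refl' anti' trans' total'] Ceq x y Px Py; split=> [xy B|lexy].
    by rewrite Ceq => -[BP Bini] By; apply: (Bini _ _ Px By).
  (* The principal initial segment of [le'] at [y] is a member of [C] that contains [y]. *)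
  have /lexy[//|] : C [set z | P z /\ le' z y]; last by [].
  rewrite Ceq; split=> [z []//|z t Pz [Pt ty] zt]; split=> //; exact: trans' zt ty.
  by split=> //; apply: refl'.
Qed.

(** * Positive systems and simple roots *)

Definition lin_form {R : numDomainType} {V : lmodType R} (f : V -> R) : Prop :=
  forall c x y, f (c *: x + y) = c * f x + f y.

Section LinForm.
Variables (R : numDomainType) (V : lmodType R) (f : V -> R).
Hypothesis lf : lin_form f.

Lemma lin_formD x y : f (x + y) = f x + f y.
Proof. by rewrite -[x]scale1r lf mul1r scale1r. Qed.
Lemma lin_form0 : f 0 = 0.
Proof. by apply: (addrI (f 0)); rewrite -lin_formD !addr0. Qed.
Lemma lin_formZ c x : f (c *: x) = c * f x.
Proof. by rewrite -[_ *: _]addr0 lf lin_form0 addr0. Qed.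
Lemma lin_formN x : f (- x) = - f x.
Proof. by rewrite -scaleN1r lin_formZ mulN1r. Qed.
Lemma lin_formB x y : f (x - y) = f x - f y.
Proof. by rewrite lin_formD lin_formN. Qed.
Lemma lin_form_sum (I : Type) (s : seq I) (F : I -> V) :
  f (\sum_(i <- s) F i) = \sum_(i <- s) f (F i).
Proof. by elim: s => [|i s IH]; rewrite ?big_nil ?lin_form0// !big_cons lin_formD IH. Qed.

End LinForm.
Arguments lin_formD {R V f} lf.
Arguments lin_form0 {R V f} lf.
Arguments lin_formZ {R V f} lf.
Arguments lin_formN {R V f} lf.
Arguments lin_formB {R V f} lf.
Arguments lin_form_sum {R V f} lf {I}.

Lemma dotvE {R : realType} {n : nat} (u v : 'rV[R]_n) :
  dotv u v = \sum_i u 0 i * v 0 i.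
Proof. by rewrite /dotv mxE; apply: eq_bigr => i _; rewrite mxE. Qed.

Lemma dotvC {R : realType} {n : nat} (u v : 'rV[R]_n) : dotv u v = dotv v u.
Proof. by rewrite !dotvE; apply: eq_bigr => i _; rewrite mulrC. Qed.

Lemma dotvBl {R : realType} {n : nat} (u v w : 'rV[R]_n) :
  dotv (u - v) w = dotv u w - dotv v w.
Proof. by rewrite /dotv mulmxBl !mxE. Qed.

Lemma dotvZl {R : realType} {n : nat} c (u w : 'rV[R]_n) :
  dotv (c *: u) w = c * dotv u w.
Proof. by rewrite /dotv -scalemxAl !mxE. Qed.

Lemma dotvBr {R : realType} {n : nat} (u v w : 'rV[R]_n) :
  dotv w (u - v) = dotv w u - dotv w v.
Proof. by rewrite !(dotvC w) dotvBl. Qed.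

Lemma dotvZr {R : realType} {n : nat} c (u w : 'rV[R]_n) :
  dotv w (c *: u) = c * dotv w u.
Proof. by rewrite !(dotvC w) dotvZl. Qed.

Lemma dotv_ge0 {R : realType} {n : nat} (u : 'rV[R]_n) : 0 <= dotv u u.
Proof. by rewrite dotvE; apply: sumr_ge0 => i _; rewrite -expr2 sqr_ge0. Qed.

Lemma dotv_eq0 {R : realType} {n : nat} (u : 'rV[R]_n) : dotv u u = 0 -> u = 0.
Proof.
rewrite dotvE => /eqP; rewrite psumr_eq0; last by move=> i _; rewrite -expr2 sqr_ge0.
move=> /allP h; apply/rowP => i; rewrite mxE.
by have := h i (mem_index_enum _); rewrite mulf_eq0 orbb => /eqP.
Qed.

Section PositiveSystems.
Variables (R : realType) (n N : nat) (pi : {linear 'rV[R]_N -> 'rV[R]_n}).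
Implicit Types (x y z : 'rV[R]_N) (Psi Q : set 'rV[R]_N) (f : 'rV[R]_N -> R).

(** The form is pulled back along [pi], which treats both cases at once: [pi] is the identity for
    finite systems and forgets the [delta] coordinate for affine ones. *)
Definition cartan x y : R := 2 * dotv (pi x) (pi y) / dotv (pi y) (pi y).

Definition srefl y x := x - cartan x y *: y.

Definition root_datum (Phi : set 'rV[R]_n) Psi : Prop :=
  (forall x, Psi x -> Phi (pi x)) /\
  (forall x y, Psi x -> Psi y -> Psi (srefl x y)).

Definition positive_system Psi Q : Prop :=
  [/\ Q `<=` Psi, (forall x, Psi x -> Q x \/ Q (- x)),
      (forall x, Q x -> ~ Q (- x)) &
      (forall x y z, Q x -> Q y -> Psi z -> span2p x y z -> Q z)].

(** Positive integer values allow minimal choices; the condition on the kernel of [pi] lets the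
    height tell apart distinct roots with the same projection. *)
Definition height_on Q f : Prop :=
  [/\ lin_form f,
      (forall v, pi v = 0 -> f v = 0 -> v = 0) &
      (forall x, Q x -> exists m : nat, f x = m.+1%:R)].

Definition simple_in Q b : Prop := Q b /\ forall x, Q x -> x <> b -> Q (srefl b x).

Lemma cartanB x y z : cartan (x - y) z = cartan x z - cartan y z.
Proof. by rewrite /cartan linearB dotvBl mulrBr mulrBl. Qed.

Lemma cartanZ c x z : cartan (c *: x) z = c * cartan x z.
Proof. by rewrite /cartan linearZ dotvZl /=; ring. Qed.

Lemma cartanN x z : cartan (- x) z = - cartan x z.
Proof. by rewrite -sub0r cartanB -(scale0r 0) cartanZ mul0r sub0r. Qed.

Lemma cartanD x y z : cartan (x + y) z = cartan x z + cartan y z.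
Proof. by rewrite -[y]opprK cartanB cartanN !opprK. Qed.

Lemma cartanNr x y : cartan x (- y) = - cartan x y.
Proof.
rewrite /cartan linearN -scaleN1r dotvZl !dotvZr !mulN1r opprK.
by rewrite mulrN mulNr.
Qed.

Lemma sreflD b x y : srefl b (x + y) = srefl b x + srefl b y.
Proof. by rewrite /srefl cartanD; apply/rowP=> i; rewrite !mxE; ring. Qed.

Lemma sreflZ b c x : srefl b (c *: x) = c *: srefl b x.
Proof. by rewrite /srefl cartanZ; apply/rowP=> i; rewrite !mxE; ring. Qed.

Lemma sreflN b x : srefl b (- x) = - srefl b x.
Proof. by rewrite -scaleN1r sreflZ scaleN1r. Qed.

Lemma span2pC (V : lmodType R) (a b g : V) : span2p a b g -> span2p b a g.
Proof. by move=> [c [d [c0 [d0 ->]]]]; exists d, c; rewrite addrC. Qed.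

Lemma span2pN (V : lmodType R) (a b g : V) : span2p a b g -> span2p (- a) (- b) (- g).
Proof.
by move=> [c [d [c0 [d0 ->]]]]; exists c, d; rewrite !scalerN -opprD.
Qed.

Lemma span2p_solve (V : lmodType R) (a b g : V) c d : 0 < c -> 0 <= d ->
  g = c *: a + d *: b -> span2p g (- b) a.
Proof.
move=> c0 d0 ->; exists c^-1, (c^-1 * d); rewrite invr_ge0 mulr_ge0 ?invr_ge0 ?(ltW c0)//.
do 2!split=> //.
by rewrite scalerDr !scalerA mulVf ?gt_eqF// scale1r scalerN addrK.
Qed.

Definition neg_set Q : set 'rV[R]_N := [set x | Q (- x)].

Lemma positive_system_neg Psi Q : (forall x, Psi x -> Psi (- x)) ->
  positive_system Psi Q -> positive_system Psi (neg_set Q).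
Proof.
move=> PsiN [QP Qt Qa Qc]; split=> [x /QP/PsiN|x px|x|x y z Qx Qy pz xyz].
- by rewrite opprK.
- by apply: Qt; apply: PsiN.
- exact: Qa.
- by apply: (Qc _ _ _ Qx Qy); [exact: PsiN|exact: span2pN].
Qed.

Section Datum.
Variables (Phi : set 'rV[R]_n) (Psi : set 'rV[R]_N).
Hypotheses (rsPhi : finite_root_system Phi) (rdPsi : root_datum Phi Psi).

Lemma root_normP x : Psi x -> 0 < dotv (pi x) (pi x).
Proof.
case: rsPhi rdPsi => _ Phi0 _ _ _ [piPhi _] /piPhi px.
by rewrite lt_def dotv_ge0 andbT; apply/eqP=> /dotv_eq0 p0; apply: Phi0; rewrite -p0.
Qed.

Lemma cartanxx x : Psi x -> cartan x x = 2.
Proof. by move=> /root_normP p; rewrite /cartan mulfK// gt_eqF. Qed.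

Lemma srefl_xx x : Psi x -> srefl x x = - x.
Proof. by move=> px; rewrite /srefl cartanxx//; apply/rowP=> i; rewrite !mxE; ring. Qed.

Lemma sreflK b x : Psi b -> srefl b (srefl b x) = x.
Proof.
move=> pb; rewrite {1}/srefl /srefl cartanB cartanZ cartanxx//.
by apply/rowP=> i; rewrite !mxE; ring.
Qed.

Lemma rootN x : Psi x -> Psi (- x).
Proof. by move=> px; rewrite -srefl_xx//; apply: rdPsi.2. Qed.

Lemma cartan_int x y : Psi x -> Psi y -> exists z : int, cartan x y = z%:~R.
Proof. by case: rsPhi rdPsi => _ _ _ Pint _ [piPhi _] px py; apply: Pint; apply: piPhi. Qed.

Lemma cartan_srefl x y : Psi x -> Psi y -> cartan x (srefl x y) = - cartan x y.
Proof.
move=> /root_normP px /root_normP py.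
rewrite /cartan /srefl linearB linearZ /= /cartan !(dotvBr, dotvBl, dotvZl, dotvZr).
rewrite [dotv (pi y) (pi x)]dotvC; set a := dotv (pi x) (pi x); set b := dotv (pi y) (pi y).
set c := dotv _ _; have -> : 2 * c / a * a = 2 * c by rewrite mulfVK// gt_eqF.
have -> : b - 2 * c / a * c - 2 * c / a * (c - 2 * c) = b by ring.
by rewrite /c; ring.
Qed.

(** This is Cauchy-Schwarz, read off from the squared norm of [b *: pi x - c *: pi y], which equals
    [b * (a * b - c * c)]. *)
Lemma cartan_cauchy x y : Psi x -> Psi y -> cartan x y * cartan y x <= 4.
Proof.
move=> px py; have := root_normP _ px; have := root_normP _ py; rewrite /cartan.
rewrite [dotv (pi y) (pi x)]dotvC; set a := dotv (pi x) (pi x); set b := dotv (pi y) (pi y).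
set c := dotv _ _ => b0 a0.
have : 0 <= dotv (b *: pi x - c *: pi y) (b *: pi x - c *: pi y) by exact: dotv_ge0.
have -> : dotv (b *: pi x - c *: pi y) (b *: pi x - c *: pi y) = b * (a * b - c * c).
  rewrite !(dotvBr, dotvBl, dotvZl, dotvZr) [dotv (pi y) (pi x)]dotvC -/a -/b -/c.
  by ring.
rewrite pmulr_rge0// subr_ge0 => h.
have -> : 2 * c / b * (2 * c / a) = 4 * ((c * c) / (a * b)) by field; rewrite !gt_eqF.
by rewrite ger_pMr// ler_pdivrMr ?mul1r// mulr_gt0.
Qed.

(** In the equality case of Cauchy-Schwarz the projections are proportional; [Phi] is reduced, so
    the factor is 1 or -1, and the sign excludes -1. *)
Lemma cartan_cauchy_eq x y : Psi x -> Psi y -> cartan x y * cartan y x = 4 ->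
  0 < cartan x y -> pi x = pi y.
Proof.
move=> px py; have := root_normP _ px; have := root_normP _ py; rewrite /cartan.
rewrite [dotv (pi y) (pi x)]dotvC; set a := dotv (pi x) (pi x); set b := dotv (pi y) (pi y).
set c := dotv _ _ => b0 a0.
have -> : 2 * c / b * (2 * c / a) = 4 * ((c * c) / (a * b)) by field; rewrite !gt_eqF.
rewrite -[RHS]mulr1 => /(mulfI _) h; have {}h : c * c / (a * b) = 1 by apply: h; rewrite pnatr_eq0.
have {}h : c * c = a * b.
  by rewrite -[LHS](@mulfVK _ (a * b)) ?h ?mul1r// gt_eqF// mulr_gt0.
have /dotv_eq0 : dotv (b *: pi x - c *: pi y) (b *: pi x - c *: pi y) = 0.
  have -> : dotv (b *: pi x - c *: pi y) (b *: pi x - c *: pi y) = b * (a * b - c * c).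
    rewrite !(dotvBr, dotvBl, dotvZl, dotvZr) [dotv (pi y) (pi x)]dotvC -/a -/b -/c.
    by ring.
  by rewrite h subrr mulr0.
move=> /subr0_eq e; have {}e : pi x = (c / b) *: pi y.
  by rewrite mulrC -scalerA -e scalerA mulVf ?scale1r// gt_eqF.
case: rsPhi rdPsi => _ _ _ _ red [piPhi _].
have := red _ (c / b) (piPhi _ py); rewrite -e => /(_ (piPhi _ px))[cb _|cb].
  by rewrite e cb scale1r.
by rewrite -mulrA cb mulrN1 oppr_gt0 ltNge ler0n.
Qed.

Lemma srefl_root b x : Psi b -> Psi x -> Psi (srefl b x).
Proof. exact: rdPsi.2. Qed.

Lemma positive_system_srefl Q b : Psi b -> positive_system Psi Q ->
  positive_system Psi [set x | Q (srefl b x)].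
Proof.
move=> pb [QP Qt Qa Qc]; split=> [x /= /QP/(srefl_root _ _ pb)|x px|x|x y z /= Qx Qy pz].
- by rewrite sreflK.
- by rewrite /= sreflN; apply: Qt; apply: srefl_root.
- by rewrite /= sreflN; apply: Qa.
move=> [c [d [c0 [d0 ez]]]]; apply: Qc Qx Qy _ _; first exact: srefl_root.
exists c, d; by rewrite ez sreflD !sreflZ.
Qed.

(** The converse direction comes from applying simplicity to [- x]. Hence reflecting [Q] in a simple
    root [b] only replaces [b] by [- b]. *)
Lemma simple_flip Q b x : positive_system Psi Q -> simple_in Q b -> Psi x ->
  x <> b -> x <> - b -> Q (srefl b x) <-> Q x.
Proof.
move=> [QP Qt Qa Qc] [Qb sb] px xb xNb; split=> [Qsx|Qx]; last exact: sb.
case: (Qt _ px) => // QNx; case: (Qa _ Qsx); rewrite -sreflN; apply: sb => //.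
by move=> e; apply: xNb; rewrite -e opprK.
Qed.

Lemma cartan_nat x y : Psi x -> Psi y -> 0 < cartan x y ->
  exists k : nat, cartan x y = k.+1%:R.
Proof.
move=> px py; have [[[|k]|k] ->] := cartan_int _ _ px py; first by rewrite ltxx.
  by exists k.
by rewrite ltr0z.
Qed.

Lemma cartan_gt0 x y : Psi x -> Psi y -> 0 < cartan x y -> 0 < cartan y x.
Proof.
move=> /root_normP px /root_normP py; rewrite /cartan [dotv (pi y) (pi x)]dotvC.
by rewrite pmulr_lgt0 ?invr_gt0// => c0; rewrite pmulr_lgt0 ?invr_gt0.
Qed.

(** * Heights and the existence of simple roots *)

Section Height.
Variables (Q : set 'rV[R]_N) (f : 'rV[R]_N -> R).
Hypotheses (psQ : positive_system Psi Q) (hf : height_on Q f).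

Let lf : lin_form f. Proof. by case: hf. Qed.

Lemma height_gt0 x : Q x -> 0 < f x.
Proof. by case: hf => _ _ h /h[m ->]; rewrite ltr0n. Qed.

Lemma height_min (A : set 'rV[R]_N) : A `<=` Q -> (exists x, A x) ->
  exists2 x, A x & forall y, A y -> f x <= f y.
Proof.
move=> AQ [x0 Ax0]; have [_ _ h] := hf.
have [m fm] := h _ (AQ _ Ax0); elim/ltn_ind: m x0 Ax0 fm => m IH x Ax fx.
have [[y Ay fyx]|nlt] := EM (exists2 y, A y & f y < f x).
  have [k fy] := h _ (AQ _ Ay); apply: (IH k _ y) => //.
  by move: fyx; rewrite fx fy ltr_nat.
by exists x => // y Ay; rewrite leNgt; apply/negP => fyx; apply: nlt; exists y.
Qed.

(* If [x] is not simple, choose [y] of minimal height among the witnesses and let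
   [x = (y + u) / m'] with [u = - srefl x y]. By Cauchy-Schwarz the product of the Cartan
   integers of [x] and [y] is at most 4; the only delicate case is that of two roots with
   equal projection, where [2 y - x] would be a lower witness. *)
Lemma simple_or_split x : Q x -> simple_in Q x \/
  exists y z, [/\ Q y, Q z, f y < f x, f z < f x & span2p y z x].
Proof.
move=> Qx; have [QP Qt Qa Qc] := psQ; have px := QP _ Qx.
pose A := [set y | [/\ Q y, y <> x & ~ Q (srefl x y)]].
have [[y0 Ay0]|nA] := EM (exists y, A y); last first.
  by left; split=> // y Qy yx; apply: contrapT => nQ; apply: nA; exists y.
right; have [|y [Qy yx nQsy] ymin] := height_min A _ (ex_intro _ _ Ay0); first by move=> y [].
have py := QP _ Qy.
have fx := height_gt0 _ Qx.
have fy := height_gt0 _ Qy.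
have span_sum a b k : x = a + k *: b -> 0 <= k -> span2p a b x.
  by move=> e k0; exists 1, k; rewrite ler01 scale1r.
have reflN a : Psi a -> ~ Q (srefl x a) -> Q (- srefl x a).
  by move=> pa nQ; case: (Qt _ (srefl_root _ _ px pa)).
pose u := cartan y x *: x - y.
have uE : u = - srefl x y by rewrite /u /srefl opprB.
have Qu : Q u by rewrite uE; apply: reflN.
have pu := QP _ Qu; have fu := height_gt0 _ Qu.
have fuE : f u = cartan y x * f x - f y by rewrite (lin_formB lf) (lin_formZ lf).
have m'0 : 0 < cartan y x by rewrite -(pmulr_lgt0 _ fx) -(subrK (f y) (_ * _)) -fuE addr_gt0.
have m0 := cartan_gt0 _ _ py px m'0.
have mu : cartan x u = cartan x y.
  by rewrite uE cartanNr cartan_srefl// opprK.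
have xy1 : x = 1 *: (y + u) -> f y < f x /\ f u < f x.
  by rewrite scale1r => /(congr1 f); rewrite (lin_formD lf) => ->; rewrite ltrDl ltrDr.
have xD a b k : Q a -> Q b -> 1 <= k -> x = a + k *: b ->
    exists y z, [/\ Q y, Q z, f y < f x, f z < f x & span2p y z x].
  move=> Qa' Qb k1 e; have k0 := lt_le_trans ltr01 k1; have fa := height_gt0 _ Qa'.
  have fb := height_gt0 _ Qb; exists a, b; split=> //; last by apply: span_sum e (ltW k0).
    by rewrite e (lin_formD lf) (lin_formZ lf) ltrDl mulr_gt0.
  rewrite e (lin_formD lf) (lin_formZ lf); apply: le_lt_trans (_ : k * f b < _); last by rewrite ltrDr.
  by rewrite ler_pMl.
have [k mk] := cartan_nat _ _ px py m0; have [k' mk'] := cartan_nat _ _ py px m'0.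
have m1 : 1 <= cartan x y by rewrite mk ler1n.
have [Qyx|nQyx] := EM (Q (srefl y x)).
  by apply: (xD _ y (cartan x y) Qyx) => //; rewrite /srefl subrK.
have [Qux|nQux] := EM (Q (srefl u x)).
  by apply: (xD _ u (cartan x y) Qux) => //; rewrite -mu /srefl subrK.
have {nQyx}Qyx : Q (cartan x y *: y - x).
  by case: (Qt _ (srefl_root _ _ py px)) => //; rewrite /srefl opprB.
have {nQux}Qux : Q (cartan x y *: u - x).
  by case: (Qt _ (srefl_root _ _ pu px)) => //; rewrite /srefl opprB mu.
have fyx := height_gt0 _ Qyx; have fux := height_gt0 _ Qux.
(* The roots [cartan x y *: y - x] and [cartan x y *: u - x] have positive heights, whose sum is
   [(cartan x y * cartan y x - 2) * f x]. *)
have m'm : (2 < k'.+1 * k.+1)%N.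
  rewrite -(@ltr_nat R) natrM -mk -mk' -(ltr_pM2r fx).
  move: (addr_gt0 fyx fux); rewrite !(lin_formB lf) !(lin_formZ lf) fuE -[in X in _ -> X]subr_gt0.
  by congr (0 < _); ring.
have mm'4 : (k.+1 * k'.+1 <= 4)%N.
  by rewrite -(ler_nat R) natrM -mk -mk' cartan_cauchy.
have [k'0|k'0] := eqVneq k' 0%N.
  apply: (xD y u 1) => //; rewrite /u mk' k'0; apply/rowP=> i; rewrite !mxE; ring.
have par : (k.+1 * k'.+1 = 4)%N -> pi x = pi y.
  move=> e; apply: cartan_cauchy_eq => //.
  by rewrite mk mk' -natrM e.
have [k0|k0] := eqVneq k 0%N.
  have c1 : cartan x y = 1 by rewrite mk k0.
  (* If [y + u = 3 x], then [x] is the sum of [y - x] and [u - x]. If the second Cartan integer is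
     4, the projections coincide, which makes the first one 2 instead of 1. *)
  have [c3|c4] : k' = 2%N \/ k' = 3%N by move: m'm mm'4 k'0; rewrite k0; case: k' {mk' par} => [|[|[|[|]]]] //; [left|right].
    apply: (xD _ _ 1 Qyx Qux) => //.
    by rewrite /u c1 mk' c3; apply/rowP=> i; rewrite !mxE; ring.
  have := par; rewrite k0 c4 => /(_ erefl) pxy.
  by move: c1; rewrite /cartan pxy -/(cartan y y) cartanxx// => /eqP; rewrite (@eqr_nat _ 2 1).
have [k1 k'1] : k = 1%N /\ k' = 1%N.
  by move: mm'4 k0 k'0; clear; case: k k' => [|[|k]] [|[|k']] //; rewrite !mulSn !mulnS; lia.
have c2 : cartan x y = 2 by rewrite mk k1.
have c2' : cartan y x = 2 by rewrite mk' k'1.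
have := par; rewrite k1 k'1 => /(_ erefl) pxy.
have [_ kerf _] := hf.
(* Both [u = 2 x - y] and [2 y - x] are witnesses as well, so minimality of [y] gives [f y <= f x]
   and [f x <= f y]. Equal height and equal projection then force [x = y]. *)
have fyu : f y <= f u.
  apply: ymin; split=> //; last by rewrite uE sreflN sreflK//; apply: Qa.
  by rewrite /u c2' => e; apply: yx; apply/rowP=> i; move/rowP/(_ i): e; rewrite !mxE; lra.
have fy2 : f y <= f (2 *: y - x).
  apply: ymin; split=> [|e|]; first by rewrite -c2.
    by apply: yx; apply/rowP=> i; move/rowP/(_ i): e; rewrite !mxE; lra.
  have -> : srefl x (2 *: y - x) = - (cartan x y *: u - x).
    rewrite /srefl cartanB cartanZ cartanxx// /u c2' c2.
    by apply/rowP=> i; rewrite !mxE; ring.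
  exact: Qa.
have fxy : f x = f y.
  by move: fyu fy2; rewrite fuE (lin_formB lf) (lin_formZ lf) c2'; lra.
exfalso; apply: yx; apply/subr0_eq/kerf; first by rewrite linearB pxy subrr.
by rewrite (lin_formB lf) fxy subrr.
Qed.
(** If a root of minimal height outside [Q2] split, its two lower parts would lie in [Q2], and so
    would their cone. *)
Lemma simple_outside Q2 : positive_system Psi Q2 ->
  (exists x, Q x /\ ~ Q2 x) -> exists2 b, simple_in Q b & ~ Q2 b.
Proof.
move=> [_ _ _ Q2c] ex; have [QP _ _ _] := psQ.
have [|x [Qx nQ2x] xmin] := height_min [set x | Q x /\ ~ Q2 x] _ ex; first by move=> x [].
exists x => //; have [//|[y [z [Qy Qz fyx fzx xspan]]]] := simple_or_split _ Qx.
have small t : Q t -> f t < f x -> Q2 t.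
  by move=> Qt ftx; apply: contrapT => nQ2t; have := xmin _ (conj Qt nQ2t); rewrite leNgt ftx.
by exfalso; apply: nQ2x; apply: Q2c xspan; [exact: small|exact: small|exact: QP].
Qed.

End Height.

(** Induction on the number of roots of [Q0] missing from [Q]. A simple root [b] of [Q0] outside [Q]
    is flipped, the height is composed with the reflection in [b], and [b] leaves the list [s]. *)
Lemma height_exists Q0 f0 Q (s : seq 'rV[R]_N) :
  positive_system Psi Q0 -> height_on Q0 f0 -> positive_system Psi Q ->
  (forall x, Q0 x -> ~ Q x -> x \in s) -> exists f, height_on Q f.
Proof.
move=> + + psQ; have [QP Qt Qa Qc] := psQ.
have [k] := ubnP (size s); elim: k => // k IH in s Q0 f0 *.
move=> sk ps0 hf0 Q0s; have [Q0P Q0t Q0a _] := ps0.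
have [ex|nex] := EM (exists x, Q0 x /\ ~ Q x); last first.
  have Q0Q x : Q0 x -> Q x by move=> Qx; apply: contrapT => nQ; apply: nex; exists x.
  exists f0; case: hf0 => hl hk hv; split=> // x Qx; apply: hv.
  by have [//|/Q0Q/(Qa _ Qx)] := Q0t _ (QP _ Qx).
have [b sb nQb] := simple_outside _ _ ps0 hf0 _ psQ ex.
have Q0b := sb.1; have pb := Q0P _ Q0b.
have QNb : Q (- b) by have [] := Qt _ pb.
apply: (IH [seq x <- s | x != b] [set x | Q0 (srefl b x)] (fun x => f0 (srefl b x))).
- rewrite ltnS in sk; apply: leq_trans sk; rewrite size_filter.
  have := count_predC (pred1 b) s; rewrite -[size s]/(size s) => <-.
  rewrite -[X in (X < _)%N]add0n ltn_add2r -has_count has_pred1.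
  exact: Q0s.
- exact: positive_system_srefl.
- case: hf0 => hl hk hv; split=> [c x y|v v0 fv|x]; [by rewrite sreflD sreflZ hl| |exact: hv].
  (* Reflections fix the kernel of [pi] pointwise. *)
  apply: hk => //; move: fv; rewrite /srefl /cartan v0.
  by rewrite -(scale0r 0) dotvZl mul0r mulr0 mul0r !scale0r subr0.
- move=> x /= Q0sx nQx; rewrite mem_filter.
  have xb : x <> b by move=> e; apply: (Q0a _ Q0b); rewrite -srefl_xx// -[X in srefl _ X]e.
  have xNb : x <> - b by move=> e; apply: nQx; rewrite e.
  have px : Psi x by rewrite -(sreflK _ x pb); apply/srefl_root/Q0P.
  rewrite Q0s ?andbT//; first exact/eqP.
  exact/(simple_flip _ _ _ ps0 sb px xb xNb).
Qed.

Lemma simple_outside_finite Q0 f0 Q Q2 (s : seq 'rV[R]_N) :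
  positive_system Psi Q0 -> height_on Q0 f0 -> positive_system Psi Q ->
  (forall x, Q0 x -> ~ Q x -> x \in s) -> positive_system Psi Q2 ->
  (exists x, Q x /\ ~ Q2 x) -> exists2 b, simple_in Q b & ~ Q2 b.
Proof.
move=> ps0 h0 psQ Q0s ps2 ex; have [f hf] := height_exists _ _ _ _ ps0 h0 psQ Q0s.
exact: (simple_outside _ _ psQ hf).
Qed.

(** * Biclosed sets as positive systems *)

Section Biclosed.
Variables (P : set 'rV[R]_N) (f : 'rV[R]_N -> R).
Hypotheses (psP : positive_system Psi P) (hf : height_on P f).

Definition sign_set (B : set 'rV[R]_N) : set 'rV[R]_N :=
  [set x | P x /\ ~ B x \/ P (- x) /\ B (- x)].

Lemma positive_system_sign B : biclosed P B -> positive_system Psi (sign_set B).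
Proof.
move=> [BP Bc]; have [PP Pt Pa Pc] := psP; have [lf _ _] := hf.
(* The only delicate cones mix [x] in [P \ B] with the opposite [y] of a root of [B]. Solving
   [z = c x + d y] for [x], or for [- y] when [- z] is positive, brings the situation back to
   biclosedness of [B]; heights exclude that the coefficient to be inverted vanishes. *)
have mixed x y z : P x -> ~ B x -> P (- y) -> B (- y) -> Psi z -> span2p x y z ->
    sign_set B z.
  move=> Px nBx PNy BNy pz [c [d [c0 [d0 zE]]]].
  have [Pz|PNz] := Pt _ pz.
    left; split=> // Bz; apply: nBx; apply: (Bc _ _ _ Pz PNy Px _).1 => //.
    apply: (@span2p_solve _ _ _ _ c d) => //; rewrite lt_def c0 andbT; apply/eqP => c00.
    have := height_gt0 _ _ hf _ Pz; rewrite zE c00 scale0r add0r (lin_formZ lf).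
    have := height_gt0 _ _ hf _ PNy; rewrite (lin_formN lf) oppr_gt0 => fy.
    by rewrite ltNge mulr_ge0_le0// ltW.
  right; split=> //; apply: contrapT => nBz.
  apply: (Bc _ _ _ PNz Px PNy _).2 BNy => //.
  rewrite -[x]opprK; apply: (@span2p_solve _ _ _ _ d c) => //; last first.
    by rewrite zE opprD !scalerN addrC.
  rewrite lt_def d0 andbT; apply/eqP => d00.
  have := height_gt0 _ _ hf _ PNz; rewrite zE d00 scale0r addr0 -scalerN (lin_formZ lf).
  have := height_gt0 _ _ hf _ Px; rewrite (lin_formN lf) => fx.
  by rewrite ltNge mulrN oppr_le0 mulr_ge0// ltW.
split=> [x [[/PP//]|[/PP/rootN]]|x px|x|x y z]; first by rewrite opprK.
- rewrite /sign_set /= opprK; have [Bx|nBx] := EM (B x).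
    have Px := BP _ Bx; right; right; split=> //.
  have [Px|PNx] := Pt _ px; first by left; left.
  have [BNx|nBNx] := EM (B (- x)); first by left; right.
  by right; left.
- rewrite /sign_set /= opprK => -[[Px nBx]|[PNx BNx]] [[PNx' nBNx]|[Px' Bx]] //.
  exact: Pa Px PNx'.
  exact: Pa Px' PNx.
- move=> [[Px nBx]|[Px Bx]] [[Py nBy]|[Py By]] pz xyz.
  + have Pz := Pc _ _ _ Px Py pz xyz.
    by left; split=> //; apply: (Bc _ _ _ Px Py Pz xyz).2.
  + exact: mixed xyz.
  + by apply: (mixed y x) => //; apply: span2pC.
  + have xyz' := span2pN _ _ _ _ xyz.
    have Pz := Pc _ _ _ Px Py (rootN _ pz) xyz'.
    by right; split=> //; apply: (Bc _ _ _ Px Py Pz xyz').1.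
Qed.

Lemma biclosed_outside Q : positive_system Psi Q -> biclosed P [set x | P x /\ ~ Q x].
Proof.
move=> [QP Qt Qa Qc]; have [PP _ _ _] := psP; split=> [x []//|a b g Pa Pb Pg abg].
have NQ t : P t -> ~ Q t -> Q (- t) by move=> /PP/Qt[].
have QN t : P t -> ~ (P t /\ ~ Q t) -> Q t.
  by move=> Pt nPQ; apply: contrapT => nQ; apply: nPQ.
split=> [[_ na] [_ nb]|/(QN _ Pa) Qa' /(QN _ Pb) Qb [_]].
  split=> // Qg; apply: (Qa _ Qg); apply: Qc (NQ _ Pa na) (NQ _ Pb nb) _ _.
    exact/rootN/PP.
  exact: span2pN.
by apply; apply: Qc abg => //; apply: PP.
Qed.

(** Under the encoding, the roots of [Q1] outside [Q2] are those of [B2 \ B1]. Reflecting [Q1] in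
    such a simple root adds it to [B1]; a simple root of the negated [Q2] is removed from [B2] in
    the same way. *)
Lemma one_step_of_simple :
  (forall Q1 Q2, positive_system Psi Q1 -> positive_system Psi Q2 ->
     (forall x, Q1 x -> ~ Q2 x -> P x) -> (exists x, Q1 x /\ ~ Q2 x) ->
     (exists2 b, simple_in Q1 b & ~ Q2 b) \/
     (exists2 b, simple_in (neg_set Q2) b & ~ neg_set Q1 b)) ->
  forall B1 B2, biclosed P B1 -> biclosed P B2 -> B1 `<=` B2 -> B1 <> B2 ->
  exists x, [/\ B2 x, ~ B1 x &
    biclosed P (B1 `|` [set x]) \/ biclosed P (B2 `\` [set x])].
Proof.
move=> core B1 B2 bi1 bi2 B12 neB; have [PP Pt Pa _] := psP.
have ps1 := positive_system_sign _ bi1; have ps2 := positive_system_sign _ bi2.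
have [Q1P Q1t Q1a _] := ps1; have [Q2P Q2t Q2a _] := ps2.
have diff x : sign_set B1 x -> ~ sign_set B2 x -> [/\ P x, ~ B1 x & B2 x].
  move=> [[Px nB1x]|[PNx BNx]] nQ2; last by case: nQ2; right; split=> //; apply: B12.
  by split=> //; apply: contrapT => nB2x; apply: nQ2; left.
have inP B x : P x -> sign_set B x <-> ~ B x.
  move=> Px; split=> [[[]//|[/(Pa _ Px)]]|nBx] //; by left.
have [||[b sb nQ2b]|[b sb nQ1b]] := core _ _ ps1 ps2.
- by move=> x Q1x /(diff _ Q1x)[].
- apply: contrapT => nex; apply: neB; apply/seteqP; split=> // x B2x.
  have Px := bi2.1 _ B2x; apply: contrapT => nB1x; apply: nex; exists x.
  by split; [apply/inP|move/(inP _ _ Px)].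
- have [Pb nB1b B2b] := diff _ sb.1 nQ2b; exists b; split=> //; left.
  have pb := PP _ Pb; have := biclosed_outside _ (positive_system_srefl _ _ pb ps1).
  congr biclosed; apply/seteqP; split=> x /=.
    move=> [Px nQ]; have [->|xb] := EM (x = b); first by right.
    left; apply: contrapT => nBx; apply: nQ.
    apply/(simple_flip _ _ _ ps1 sb (PP _ Px) xb); last exact/inP.
    by move=> e; apply: (Pa _ Pb); rewrite -e.
  move=> [Bx|->]; last by split=> //; rewrite srefl_xx//; apply: Q1a; exact: sb.1.
  have Px := bi1.1 _ Bx; split=> //.
  move=> /(simple_flip _ _ _ ps1 sb (PP _ Px)) h; apply: ((inP B1 x Px).1 _ Bx); apply: h.
    by move=> e; apply: nB1b; rewrite -e.
  by move=> e; apply: (Pa _ Pb); rewrite -e.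
- have psN := positive_system_neg _ _ rootN ps2.
  have pb : Psi b by rewrite -[b]opprK; apply/rootN/Q2P/sb.1.
  have Q1b : sign_set B1 b by have [|] := Q1t _ pb.
  have nQ2b : ~ sign_set B2 b by move=> /Q2a; apply; exact: sb.1.
  have [Pb nB1b B2b] := diff _ Q1b nQ2b; exists b; split=> //; right.
  have := biclosed_outside _ (positive_system_srefl _ _ pb ps2).
  have flip x : P x -> x <> b -> sign_set B2 (srefl b x) <-> sign_set B2 x.
    move=> Px xb; have := simple_flip _ _ (- x) psN sb (rootN _ (PP _ Px)).
    rewrite sreflN /neg_set /= !opprK; apply.
      by move=> e; apply: (Pa _ Pb); rewrite -e opprK.
    by move=> /oppr_inj//.
  congr biclosed; apply/seteqP; split=> x /= [].
    move=> Px nQ; split=> [|e]; last by apply: nQ; rewrite e srefl_xx//; exact: sb.1.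
    apply: contrapT => nBx; apply: nQ; apply/flip => //; last exact/inP.
    by move=> e; apply: nBx; rewrite e.
  move=> Bx xb; have Px := bi2.1 _ Bx; split=> // /(flip _ Px xb).
  by move=> /(inP _ _ Px).
Qed.

End Biclosed.

(** With finitely many roots every positive system differs finitely from [P], so [B1] can always be
    enlarged. *)
Lemma finite_chain P f C (s : seq 'rV[R]_N) :
  positive_system Psi P -> height_on P f -> (forall x, Psi x -> x \in s) ->
  maximal_biclosed_chain P C -> chain_is_initial_segments_of_unique_order P C.
Proof.
move=> psP hf Ps; apply: chain_of_one_step; apply: (one_step_of_simple _ _ psP hf).
move=> Q1 Q2 ps1 ps2 _ ex; left; apply: (simple_outside_finite _ _ _ _ s psP hf ps1) => //.
by move=> x Px _; apply: Ps; case: psP => PP _ _ _; apply: PP.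
Qed.

End Datum.
End PositiveSystems.

(** * Affine root systems *)

Lemma affv_lin {R : realType} {n : nat} (c d k l : R) (a b : 'rV[R]_n) :
  c *: affv a k + d *: affv b l = affv (c *: a + d *: b) (c * k + d * l).
Proof.
by rewrite /affv !scale_row_mx !scale_scalar_mx add_row_mx -raddfD.
Qed.

Lemma affvN {R : realType} {n : nat} (k : R) (a : 'rV[R]_n) :
  - affv a k = affv (- a) (- k).
Proof.
have := affv_lin (-1) 0 k 0 a 0.
by rewrite !scale0r !addr0 !scaleN1r mulN1r mul0r addr0.
Qed.

Lemma affv_proj {R : realType} {n : nat} (k : R) (a : 'rV[R]_n) : lsubmx (affv a k) = a.
Proof. exact: row_mxKl. Qed.

(** As a consequence, a set closed under cones meets every [delta]-string in an interval. *)
Lemma affv_between {R : realType} {n : nat} (a : 'rV[R]_n) (i k j : R) :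
  i <= k -> k <= j -> span2p (affv a i) (affv a j) (affv a k).
Proof.
move=> ik kj; have [ij|ji] := ltP i j.
  exists ((j - k) / (j - i)), ((k - i) / (j - i)).
  have ji0 : 0 <= (j - i)^-1 by rewrite invr_ge0 subr_ge0 ltW.
  rewrite !mulr_ge0 ?subr_ge0//; do 2!split=> //.
  have ji1 : j - i != 0 by rewrite subr_eq0 gt_eqF.
  have e1 : (j - k) / (j - i) + (k - i) / (j - i) = 1 by field.
  by rewrite affv_lin -scalerDl e1 scale1r; congr affv; field.
have -> : k = i by apply/eqP; rewrite eq_le ik andbT (le_trans kj).
by exists 1, 0; rewrite scale1r scale0r addr0 ler01.
Qed.

Section Affine.
Variables (R : realType) (n : nat) (Phi : set 'rV[R]_n).
Hypothesis rsPhi : finite_root_system Phi.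
Local Notation proj := (lsubmx : {linear 'rV[R]_(n + 1) -> 'rV[R]_n}).
Implicit Types (a b g : 'rV[R]_n) (Q : set 'rV[R]_(n + 1)) (J : set 'rV[R]_n).

Lemma srefl_affv a b (k l : R) : srefl _ _ _ proj (affv b l) (affv a k) =
  affv (reflv b a) (k - (2 * dotv a b / dotv b b) * l).
Proof.
rewrite /srefl /cartan /= !affv_proj /reflv -[affv a k]scale1r -scaleNr affv_lin.
by rewrite scale1r mul1r scaleNr mulNr.
Qed.

(** A reflection-stable [J] is allowed because simple roots are first found over a part of [Phi]
    only. *)
Lemma root_datum_affine J : J `<=` Phi -> (forall a b, J a -> J b -> J (reflv a b)) ->
  root_datum _ _ _ proj Phi (affine_roots J).
Proof.
move=> JPhi Jr; split=> [x [a [k [Ja ->]]]|_ _ [a [k [Ja ->]]] [b [l [Jb ->]]]].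
  by rewrite /= affv_proj; apply: JPhi.
rewrite srefl_affv; have [_ _ _ Pint _] := rsPhi.
have [z ->] := Pint _ _ (JPhi _ Ja) (JPhi _ Jb).
exists (reflv a b), (l - z * k); split; first exact: Jr.
by rewrite rmorphB rmorphM.
Qed.

Lemma root_datum_affine_full : root_datum _ _ _ proj Phi (affine_roots Phi).
Proof. by apply: root_datum_affine => //; case: rsPhi. Qed.

Local Notation Psi := (affine_roots Phi).
Local Notation possys := (positive_system _ _).
Local Notation simple := (simple_in _ _ _ proj).

Lemma finite_rootN a : Phi a -> Phi (- a).
Proof.
move=> pa; have [|b [k [pb]]] := rootN _ _ _ proj _ _ rsPhi root_datum_affine_full (affv a 0).
  by exists a, 0.
by rewrite affvN => /(congr1 lsubmx); rewrite !affv_proj => ->.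
Qed.

Lemma affv_root a (k : int) : Phi a -> Psi (affv a k%:~R).
Proof. by exists a, k. Qed.

Lemma affv_root_nat a (k : nat) : Phi a -> Psi (affv a k%:R).
Proof. by move=> pa; exists a, k%:Z. Qed.

(** On roots of [Phi] this is membership in [Y(Q)]. *)
Definition eventually_in Q a : Prop :=
  exists m : nat, forall k : nat, (m <= k)%N -> Q (affv a k%:R).

(** * Asymptotics along [delta]-strings *)

Section Tails.
Variable Q : set 'rV[R]_(n + 1).
Hypothesis psQ : possys Psi Q.

(** Since [Q] meets the string in an interval, a level outside [Q] above a level inside [Q] leaves
    all later levels outside. *)
Lemma eventually_dich a : Phi a -> ~ eventually_in Q a -> eventually_in (neg_set _ _ Q) a.
Proof.
move=> pa nev; have [_ Qt Qa Qc] := psQ.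
have out k : ~ Q (affv a k%:R) -> neg_set _ _ Q (affv a k%:R).
  by move=> nQ; have [] := Qt _ (affv_root_nat _ k pa).
have [[k1 Qk1]|none] := EM (exists k : nat, Q (affv a k%:R)); last first.
  by exists 0%N => k _; apply: out => Qk; apply: none; exists k.
have [k2 k12 nQk2] : exists2 k2 : nat, (k1 <= k2)%N & ~ Q (affv a k2%:R).
  apply: contrapT => nex; apply: nev; exists k1 => k k1k.
  by apply: contrapT => nQ; apply: nex; exists k.
exists k2 => k k2k; apply: out => Qk; apply: nQk2.
by apply: Qc Qk1 Qk _ _; [exact: affv_root_nat|apply: affv_between; rewrite ler_nat].
Qed.

Lemma eventually_excl a : eventually_in Q a -> ~ eventually_in (neg_set _ _ Q) a.
Proof.
move=> [k Qk] [l Ql]; have [_ _ Qa _] := psQ.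
exact: Qa _ (Qk _ (leq_maxl k l)) (Ql _ (leq_maxr k l)).
Qed.

(** Levels are matched by taking [p * M] on [a] and [b] and [(q + r) * M] on [g] for a large [M];
    positivity of [p] and [q + r] keeps these levels large. *)
Lemma eventually_comb a b g (p q r : nat) : (0 < p)%N -> (0 < q + r)%N -> Phi g ->
  p%:R *: g = q%:R *: a + r%:R *: b ->
  eventually_in Q a -> eventually_in Q b -> eventually_in Q g.
Proof.
move=> p0 qr0 pg gE [k Qk] [l Ql]; apply: contrapT => /(eventually_dich _ pg)[m Qm].
have [_ _ Qa Qc] := psQ; pose M := (k + l + m)%N.
have pM t : (0 < t)%N -> (M <= t * M)%N by move=> t0; rewrite leq_pmull.
apply: (Qa _ _ (Qm ((q + r) * M)%N _)); last by apply: leq_trans (pM _ qr0); rewrite leq_addl.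
have kM : (k <= p * M)%N by apply: leq_trans (pM _ p0); rewrite /M -addnA leq_addr.
have lM : (l <= p * M)%N by apply: leq_trans (pM _ p0); rewrite /M addnAC leq_addl.
apply: Qc (Qk _ kM) (Ql _ lM) (affv_root_nat _ _ pg) _.
have p0R : p%:R != 0 :> R by rewrite pnatr_eq0 -lt0n.
exists (q%:R / p%:R), (r%:R / p%:R); rewrite !divr_ge0//; do 2!split=> //.
rewrite affv_lin; congr affv; last by rewrite !natrM natrD; field.
by rewrite -[g](scalerK p0R) gE scalerDr !scalerA ![p%:R^-1 * _]mulrC.
Qed.

Lemma eventually_sub a b g (z : int) : eventually_in Q a -> eventually_in Q b ->
  eventually_in Q (- b) -> Phi g -> g = a - z%:~R *: b -> eventually_in Q g.
Proof.
move=> Ya Yb YNb pg; case: z => z gE.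
  apply: (eventually_comb a (- b) _ 1 1 z) => //.
  by rewrite !scale1r gE scalerN.
apply: (eventually_comb a b _ 1 1 z.+1) => //.
by rewrite !scale1r gE NegzE rmorphN scaleNr opprK.
Qed.

(** The string enters [Q] for large positive and for large negative levels, hence everywhere by
    convexity. *)
Lemma eventually_full a (k : int) : Phi a -> eventually_in Q a -> ~ eventually_in Q (- a) ->
  Q (affv a k%:~R).
Proof.
move=> pa [l Ql] /(eventually_dich _ (finite_rootN _ pa))[m Qm]; have [_ _ _ Qc] := psQ.
pose M := (l + m + `|k|)%N.
have QM : Q (affv a M%:R) by apply: Ql; rewrite /M -addnA leq_addr.
have QNM : Q (affv a (- M%:R)).
  have := Qm M; rewrite /neg_set /= affvN opprK; apply.
  by rewrite /M addnAC leq_addl.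
apply: Qc QNM QM (affv_root _ _ pa) _; apply: affv_between.
  rewrite -[M%:R]/(M%:Z%:~R) -rmorphN ler_int; rewrite /M; lia.
rewrite -[M%:R]/(M%:Z%:~R) ler_int; rewrite /M; lia.
Qed.

(* The finite roots over which [Q] is finitely different from the standard positive
   system: [a + k delta] is in [Q] for large [k], and not for large [- k]. *)
Definition finite_part : set 'rV[R]_n :=
  [set a | [/\ Phi a, eventually_in Q a & eventually_in Q (- a)]].

Lemma reflvN a b : reflv a (- b) = - reflv a b.
Proof.
by rewrite /reflv -[- b]scaleN1r dotvZl mulN1r mulrN mulNr scaleN1r scaleNr opprK opprB addrC.
Qed.

Lemma reflv_int a b : Phi a -> Phi b ->
  exists z : int, 2 * dotv b a / dotv a a = z%:~R /\ reflv a b = b - z%:~R *: a.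
Proof.
move=> pa pb; have [_ _ _ Pint _] := rsPhi; have [z zE] := Pint _ _ pa pb.
by exists z; rewrite /reflv zE.
Qed.

(** The reflection subtracts an integral multiple of [a], and both [a] and [- a] are eventually in
    [Q]. *)
Lemma eventually_reflv a b : finite_part a -> Phi b -> eventually_in Q b ->
  eventually_in Q (reflv a b).
Proof.
move=> [pa Ya YNa] pb Yb; have [z [_ rE]] := reflv_int _ _ pa pb.
by apply: (eventually_sub _ _ _ z Yb Ya YNa _ rE); case: rsPhi => _ _ + _ _; apply.
Qed.

Lemma finite_part_reflv a b : finite_part a -> finite_part b -> finite_part (reflv a b).
Proof.
move=> ja [pb Yb YNb]; split; first by case: ja => pa _ _; case: rsPhi => _ _ + _ _; apply.
  exact: eventually_reflv.
by rewrite -reflvN; apply: eventually_reflv => //; apply: finite_rootN.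
Qed.

Lemma reflv_invol a b : Phi a -> reflv a (reflv a b) = b.
Proof.
move=> pa; have a0 : dotv a a != 0.
  apply/eqP => /dotv_eq0 a0; case: rsPhi => _ + _ _ _; apply.
  by rewrite -a0.
rewrite /reflv dotvBl dotvZl mulfVK//; apply/rowP=> i; rewrite !mxE; field.
by [].
Qed.

End Tails.

Lemma possys_neg Q : possys Psi Q -> possys Psi (neg_set _ _ Q).
Proof.
apply: positive_system_neg => x; exact: (rootN _ _ _ proj _ _ rsPhi root_datum_affine_full).
Qed.

Lemma eventually_out_reflv Q a b : possys Psi Q -> finite_part Q a -> Phi b ->
  ~ eventually_in Q b -> ~ eventually_in Q (reflv a b).
Proof.
move=> psQ ja pb nYb Yr; apply: nYb; rewrite -(reflv_invol a b); last by case: ja.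
apply: eventually_reflv => //; case: ja => pa _ _.
by case: rsPhi => _ _ + _ _; apply.
Qed.

(** The roots [b], [- b] and their reflections are all eventually in the negated [Q]. If [b] were
    not orthogonal to [a], a positive multiple of [a] would be a difference of [b] and [reflv a b],
    which would put [a] eventually in the negated [Q] too. *)
Lemma reflv_cofinite Q a b : possys Psi Q -> finite_part Q a -> Phi b ->
  ~ eventually_in Q b -> ~ eventually_in Q (- b) -> dotv b a = 0.
Proof.
move=> psQ ja pb nYb nYNb; have [pa Ya YNa] := ja.
have psN := possys_neg _ psQ.
have pr : Phi (reflv a b) by case: rsPhi => _ _ + _ _; apply.
have Yb := eventually_dich _ psQ _ pb nYb.
have YNb := eventually_dich _ psQ _ (finite_rootN _ pb) nYNb.
have Yr := eventually_dich _ psQ _ pr (eventually_out_reflv _ _ _ psQ ja pb nYb).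
have YNr : eventually_in (neg_set _ _ Q) (- reflv a b).
  apply: eventually_dich => //; first exact: finite_rootN.
  by rewrite -reflvN; apply: eventually_out_reflv => //; apply: finite_rootN.
have [z [zE rE]] := reflv_int _ _ pa pb.
have a0 : dotv a a != 0.
  apply/eqP => /dotv_eq0 a0; case: rsPhi => _ + _ _ _; apply.
  by rewrite -a0.
have [z0|z0] := eqVneq z 0.
  move: zE; rewrite z0 => /eqP; rewrite !mulf_eq0 invr_eq0 (negPf a0) orbF pnatr_eq0.
  by move/eqP.
exfalso; case: z => [[|z]|z] // in zE rE z0 *.
  apply: (eventually_excl _ psQ _ Ya).
  apply: (eventually_comb _ psN b (- reflv a b) _ z.+1 1 1) => //.
  by rewrite !scale1r rE opprB addrC subrK.
apply: (eventually_excl _ psQ _ Ya).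
apply: (eventually_comb _ psN (- b) (reflv a b) _ z.+1 1 1) => //.
by rewrite !scale1r rE addKr NegzE rmorphN scaleNr opprK.
Qed.

Lemma affine_rootsS J : J `<=` Phi -> affine_roots J `<=` Psi.
Proof. by move=> JP _ [a [k [Ja ->]]]; exists a, k; split=> //; apply: JP. Qed.

Lemma possys_restrict Q J : J `<=` Phi -> (forall a, J a -> J (- a)) ->
  possys Psi Q -> possys (affine_roots J) (Q `&` affine_roots J).
Proof.
move=> JP JN [QP Qt Qa Qc]; have JS := affine_rootsS _ JP.
have PJN x : affine_roots J x -> affine_roots J (- x).
  move=> [a [k [Ja ->]]]; exists (- a), (- k); split; first exact: JN.
  by rewrite affvN rmorphN.
split=> [x []//|x Jx|x [Qx _] [QNx _]|x y z [Qx Jx] [Qy Jy] Jz xyz].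
- have [Qx|QNx] := Qt _ (JS _ Jx); first by left.
  by right; split=> //; apply: PJN.
- exact: Qa Qx QNx.
- by split=> //; apply: Qc Qx Qy (JS _ Jz) xyz.
Qed.

(** For a root over [a] outside the finite part: if only [a] is in [Y(Q)], the same holds for its
    reflection, whose whole string lies in [Q]; if only [- a] is, the root is not in [Q]; if neither
    is, orthogonality makes the reflection fix the root. *)
Lemma simple_restrict Q (v : 'rV[R]_(n + 1)) : possys Psi Q ->
  simple (Q `&` affine_roots (finite_part Q)) v -> simple Q v.
Proof.
move=> psQ [[Qv Jv] sv]; split=> // x Qx xv; have [QP Qt Qa Qc] := psQ.
have [Jx|nJx] := EM (affine_roots (finite_part Q) x).
  by have [] := sv x (conj Qx Jx) xv.
have [a [k [pa xE]]] := QP _ Qx; have [c [l [jc vE]]] := Jv.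
have pr : Phi (reflv c a) by case: jc => pc _ _; case: rsPhi => _ _ + _ _; apply.
have [Ya|nYa] := EM (eventually_in Q a); have [YNa|nYNa] := EM (eventually_in Q (- a)).
- by case: nJx; exists a, k.
- have pc : Phi c by case: jc.
  have [z [zE rE]] := reflv_int _ _ pc pa.
  rewrite xE vE srefl_affv zE -rmorphM -rmorphB.
  apply: eventually_full => //; first exact: eventually_reflv.
  by rewrite -reflvN; apply: eventually_out_reflv => //; apply: finite_rootN.
- case: (Qa _ Qx); rewrite xE affvN -rmorphN.
  by apply: eventually_full => //; [exact: finite_rootN|rewrite opprK].
- have d0 := reflv_cofinite _ _ _ psQ jc pa nYa nYNa.
  by rewrite xE vE srefl_affv /reflv d0 mulr0 mul0r mul0r scale0r !subr0 -xE.
Qed.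

(** * One-root steps in the affine case *)

Section Core.
Variables (P : set 'rV[R]_(n + 1)) (f : 'rV[R]_(n + 1) -> R).
Hypotheses (psP : possys Psi P) (hf : height_on _ _ _ proj P f).
Hypothesis P_ge0 : forall a k, P (affv a k) -> 0 <= k.

(** Over the finite part [J], the roots of [P] outside [Q] have levels at least 0 by [P_ge0] and
    below a bound [m] common to the finitely many elements of [J]. The argument for finite
    differences applies there, and its simple root stays simple in the full system. *)
Lemma simple_outside_affine Q Q' : possys Psi Q -> possys Psi Q' ->
  (exists x, [/\ Q x, affine_roots (finite_part Q) x & ~ Q' x]) ->
  exists2 v, simple Q v & ~ Q' v.
Proof.
move=> psQ psQ' [x [Qx Jx nQ'x]]; pose J := finite_part Q.
have JP : J `<=` Phi by move=> a [].
have JN a : J a -> J (- a) by move=> [pa Ya YNa]; split; rewrite ?opprK//; exact: finite_rootN.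
have rdJ := root_datum_affine _ JP (finite_part_reflv _ psQ).
have [finP _ _ _ _] := rsPhi; have [s sE] := (finite_seqP _).1 finP.
have [m mJ] : exists m : nat, forall a, a \in s -> J a ->
    forall k : nat, (m <= k)%N -> Q (affv a k%:R).
  elim: s {sE} => [|a s [m IH]]; first by exists 0%N.
  have [[pa [l Ql] YNa]|nJa] := EM (J a).
    exists (m + l)%N => b; rewrite inE => /predU1P[->|bs] Jb k mk.
      by apply: Ql; apply: leq_trans mk; rewrite leq_addl.
    by apply: IH bs Jb _ _; apply: leq_trans mk; rewrite leq_addr.
  by exists m => b; rewrite inE => /predU1P[->//|]; apply: IH.
have [||||||v sv nQ'v] := simple_outside_finite _ _ _ proj _ _ rsPhi rdJ
  (P `&` affine_roots J) f (Q `&` affine_roots J) (Q' `&` affine_roots J)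
  [seq affv a k%:R | a <- s, k <- iota 0 m].
- exact: possys_restrict.
- by case: hf => h1 h2 h3; split=> // y [/h3].
- exact: possys_restrict.
- move=> y [Py [a [k [Ja yE]]]] nQ; move: Py nQ; rewrite {}yE => Py nQ.
  have := P_ge0 _ _ Py; rewrite ler0z; case: k Py nQ => // k Py nQ _.
  apply: allpairs_f.
    by have := JP _ Ja; rewrite sE.
  rewrite mem_iota add0n /= ltnNge; apply/negP => mk; apply: nQ; split.
    by apply: mJ mk => //; have := JP _ Ja; rewrite sE.
  by exists a, k%:Z.
- exact: possys_restrict.
- by exists x; split=> // -[].
exists v; first exact: simple_restrict.
by move=> Q'v; apply: nQ'v; split=> //; case: sv => -[].
Qed.

Lemma affine_core Q1 Q2 : possys Psi Q1 -> possys Psi Q2 ->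
  (forall x, Q1 x -> ~ Q2 x -> P x) -> (exists x, Q1 x /\ ~ Q2 x) ->
  (exists2 v, simple Q1 v & ~ Q2 v) \/
  (exists2 v, simple (neg_set _ _ Q2) v & ~ neg_set _ _ Q1 v).
Proof.
move=> ps1 ps2 diffP [x [Q1x nQ2x]].
have pN1 := possys_neg _ ps1; have pN2 := possys_neg _ ps2.
have [Q1P Q1t Q1a _] := ps1; have [_ Q2t Q2a _] := ps2.
apply: contrapT => /not_orP[no1 no2].
have h1 y : Q1 y -> affine_roots (finite_part Q1) y -> Q2 y.
  move=> Q1y Jy; apply: contrapT => nQ2y; apply: no1.
  by apply: simple_outside_affine => //; exists y.
have h2 y : Q2 (- y) -> affine_roots (finite_part (neg_set _ _ Q2)) y -> Q1 (- y).
  move=> Q2y Jy; apply: contrapT => nQ1y; apply: no2.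
  by apply: simple_outside_affine => //; exists y.
have out Q a : possys Psi Q -> Phi a -> ~ eventually_in Q a ->
    eventually_in (neg_set _ _ Q) a.
  by move=> psQ pa; apply: eventually_dich.
(* Otherwise, at a large level, [Q1] contains the opposite of a root of [Q2]; this opposite lies in
   [P] but has negative level. The successor makes the level nonzero. *)
have Y21 a : Phi a -> eventually_in Q2 a -> eventually_in Q1 a.
  move=> pa [k Q2k]; apply: contrapT => /(out _ _ ps1 pa)[l Q1l].
  have Q1N := Q1l _ (leq_trans (leq_maxr k l) (leqnSn _)).
  have Q2N := Q2k _ (leq_trans (leq_maxl k l) (leqnSn _)).
  have := diffP _ Q1N (Q2a _ Q2N); rewrite affvN => /P_ge0.
  by rewrite oppr_ge0 lern0.
(* If [- a] is in [Y(Q1)], then [h1] applies to [a]. If not, [Y21] keeps [- a] out of [Y(Q2)] as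
   well, so [a] is in the finite part of the negated [Q2] and [h2] applies. *)
have Y12 a : Phi a -> eventually_in Q1 a -> eventually_in Q2 a.
  move=> pa Y1; apply: contrapT => /(out _ _ ps2 pa) Y2; have [k Q1k] := Y1.
  have [l Q2l] := Y2; have Q1M := Q1k _ (leq_maxl k l); have Q2M := Q2l _ (leq_maxr k l).
  have [Y1N|nY1N] := EM (eventually_in Q1 (- a)).
    apply: (Q2a _ _ Q2M); apply: h1 => //.
    by exists a, (maxn k l)%:Z.
  apply: (Q1a _ Q1M); apply: h2 => //; exists a, (maxn k l)%:Z; split=> //; split=> //.
  by apply: out => //; [exact: finite_rootN|move=> /(Y21 _ (finite_rootN _ pa))].
have [a [k [pa xE]]] := Q1P _ Q1x; have pNa := finite_rootN _ pa.
(* The four cases are settled by [h1], by a full string in [Q2], by a full opposite string in [Q1],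
   and by [h2]. *)
have [Y1|nY1] := EM (eventually_in Q1 a); have [Y1N|nY1N] := EM (eventually_in Q1 (- a)).
- by apply/nQ2x/h1 => //; exists a, k.
- apply: nQ2x; rewrite xE; apply: eventually_full => //; first exact: Y12.
  by move=> /(Y21 _ pNa).
- apply: (Q1a _ Q1x); rewrite xE affvN -rmorphN; apply: eventually_full => //.
  by rewrite opprK.
- apply: (Q1a _ Q1x); apply: h2.
    by have [|] := Q2t x (Q1P _ Q1x).
  exists a, k; split=> //; split=> //; apply: out => //.
    by move=> /(Y21 _ pa).
  by move=> /(Y21 _ pNa).
Qed.

Lemma affine_chain C : maximal_biclosed_chain P C ->
  chain_is_initial_segments_of_unique_order P C.
Proof.
apply: chain_of_one_step.
exact: (one_step_of_simple _ _ _ proj _ _ rsPhi root_datum_affine_full _ _ psP hf affine_core).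
Qed.

End Core.
End Affine.

(** * Height functions from a base *)

Lemma spanpD {R : numDomainType} {V : lmodType R} (S : set V) u v :
  spanp S u -> spanp S v -> spanp S (u + v).
Proof.
move=> [s [sS ->]] [t [tS ->]]; exists (s ++ t); rewrite big_cat; split=> // p.
by rewrite mem_cat => /orP[/sS|/tS].
Qed.

Lemma spanpZ {R : numDomainType} {V : lmodType R} (S : set V) (c : R) v :
  0 <= c -> spanp S v -> spanp S (c *: v).
Proof.
move=> c0 [s [sS ->]]; exists [seq (c * p.1, p.2) | p <- s]; split.
  by move=> _ /mapP[p /sS[p0 Sp] ->]; rewrite mulr_ge0.
by rewrite scaler_sumr big_map; apply: eq_bigr => p _; rewrite scalerA.
Qed.

Lemma spanp_mem {R : numDomainType} {V : lmodType R} (S : set V) v : S v -> spanp S v.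
Proof.
by move=> Sv; exists [:: (1, v)]; split=> [p|]; rewrite ?big_seq1 ?scale1r// inE => /eqP ->.
Qed.

Lemma spanp0 {R : numDomainType} {V : lmodType R} (S : set V) : spanp S 0.
Proof. by exists [::]; rewrite big_nil. Qed.

Lemma spanp_sum {R : numDomainType} {V : lmodType R} (S : set V) (s : seq V) :
  (forall x, x \in s -> S x) -> spanp S (\sum_(x <- s) x).
Proof.
elim: s => [|x s IH] sS; first by rewrite big_nil; apply: spanp0.
rewrite big_cons; apply: spanpD; first by apply/spanp_mem/sS/mem_head.
by apply: IH => y ys; apply: sS; rewrite inE ys orbT.
Qed.

Lemma lin_form_spanp_ge0 {R : numDomainType} {V : lmodType R} (f : V -> R) (S : set V) v :
  lin_form f -> (forall x, S x -> 0 <= f x) -> spanp S v -> 0 <= f v.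
Proof.
move=> lf fS [s [sS ->]]; rewrite (lin_form_sum lf) big_seq; apply: sumr_ge0 => p /sS[p0 Sp].
by rewrite (lin_formZ lf) mulr_ge0// fS.
Qed.

(** The elements of [S] are the rows of a row-free matrix [A]; [pinvmx A] reads off coordinates
    along them, and the constant column adds these up. *)
Lemma lin_indep_form {R : realType} {n : nat} (S : set 'rV[R]_n) :
  finite_set S -> lin_indep S ->
  exists2 f, lin_form f & forall x, S x -> f x = 1.
Proof.
move=> /finite_seqP[s0 S0] indS; pose s := undup s0.
have sS x : S x <-> x \in s by rewrite /s mem_undup S0.
have us : uniq s by apply: undup_uniq.
pose A : 'M[R]_(size s, n) := \matrix_(i < size s) nth 0 s i.
have freeA : row_free A.
  apply: inj_row_free => u uA.
  pose c x := if insub (index x s) is Some i then u 0 i else 0.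
  have cE (i : 'I_(size s)) : c (nth 0 s i) = u 0 i.
    by rewrite /c index_uniq// valK.
  have c0 : \sum_(x <- s) c x *: x = 0.
    rewrite -[RHS]uA mulmx_sum_row (big_nth 0) big_mkord; apply: eq_bigr => i _.
    by rewrite cE rowK.
  apply/rowP=> i; rewrite mxE -cE; apply: (indS s c us _ c0); last exact: mem_nth.
  by move=> x /sS.
exists (fun v => (v *m pinvmx A *m const_mx 1 : 'M_1) 0 0).
  by move=> c x y; rewrite !mulmxDl -!scalemxAl !mxE.
move=> x /sS xs; have xi : (index x s < size s)%N by rewrite index_mem.
have -> : x = row (Ordinal xi) A by rewrite rowK /= nth_index.
by rewrite -row_mul mulmxVp// -row_mul mul1mx !mxE.
Qed.

(** The form equal to 1 on the base counts base elements, which is the usual height; an empty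
    combination would be the zero root. *)
Lemma base_height {R : realType} {n : nat} (Phi Pi : set 'rV[R]_n) :
  finite_root_system Phi -> root_base Phi Pi ->
  exists f, [/\ lin_form f, (forall v, spanp Pi v -> 0 <= f v) &
    forall a, Phi a -> exists m : nat,
      (f a = m.+1%:R /\ spanp Pi a) \/ (f a = - m.+1%:R)].
Proof.
move=> [finP Phi0 _ _ _] [PiP indPi Pigen].
have [f lf f1] := lin_indep_form Pi (sub_finite_set PiP finP) indPi.
exists f; split=> //.
  by move=> v; apply: lin_form_spanp_ge0 => // x /f1 ->.
move=> a pa; have [s [sPi aE]] := Pigen _ pa.
have fs : f (\sum_(x <- s) x) = (size s)%:R.
  rewrite lin_form_sum// (@eq_big_seq _ _ _ _ _ _ (fun=> 1)); last by move=> x /sPi/f1.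
  by rewrite big_const_seq count_predT iter_addr_0.
case: s => [|x s] in sPi aE fs *.
  by case: Phi0; case: aE pa => ->; rewrite big_nil ?oppr0.
exists (size s); case: aE => ->; last by right; rewrite lin_formN// fs.
by left; rewrite fs; split=> //; apply: spanp_sum.
Qed.

Lemma positive_system_form {R : realType} {N : nat} (Psi : set 'rV[R]_N) f :
  lin_form f -> (forall x, Psi x -> Psi (- x)) -> (forall x, Psi x -> f x <> 0) ->
  positive_system _ _ Psi [set x | Psi x /\ 0 < f x].
Proof.
move=> lf PN f0; split=> [x []//|x px|x [px fx] [_]|x y z [px fx] [py fy] pz].
- rewrite /= (lin_formN lf); have [fx|fx|fx] := ltgtP 0 (f x); [by left| |].
    by right; rewrite oppr_gt0; split=> //; apply: PN.
  by case: (f0 _ px).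
- by rewrite (lin_formN lf) oppr_gt0 ltNge ltW.
move=> [c [d [c0 [d0 zE]]]]; split=> //.
rewrite lt_def; apply/andP; split; first by apply/eqP/f0.
by rewrite zE lf (lin_formZ lf) addr_ge0// mulr_ge0// ltW.
Qed.

(** * The finite and the affine case *)

Lemma finite_case (R : realType) (n : nat) (Phi Pi : set 'rV[R]_n) (C : set (set 'rV[R]_n)) :
  finite_root_system Phi -> root_base Phi Pi ->
  maximal_biclosed_chain (pos_roots Phi Pi) C ->
  chain_is_initial_segments_of_unique_order (pos_roots Phi Pi) C.
Proof.
move=> rs base; have [f [lf f_ge0 fPhi]] := base_height _ _ rs base.
have rd : root_datum _ _ _ idfun Phi Phi by split=> //; case: rs.
have -> : pos_roots Phi Pi = [set x | Phi x /\ 0 < f x].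
  apply/seteqP; split=> a [pa] ha; split=> //; have [m [[fa]|fa]] := fPhi _ pa => //.
  - by rewrite fa ltr0n.
  - by have := f_ge0 _ ha; rewrite fa oppr_ge0 lern0.
  - by move: ha; rewrite fa oppr_gt0 ltrn0.
have [/finite_seqP[s sE] _ _ _ _] := rs.
apply: (finite_chain _ _ _ idfun _ _ rs rd _ f _ s).
- apply: positive_system_form => // a pa; first exact: (rootN _ _ _ idfun _ _ rs rd).
  by have [m [[-> _]|->]] := fPhi _ pa => /eqP; rewrite ?oppr_eq0 pnatr_eq0.
- split=> // a [pa]; have [m [[-> _]|->]] := fPhi _ pa; first by exists m.
  by rewrite oppr_gt0 ltrn0.
- by rewrite sE.
Qed.

Lemma affine_case (R : realType) (n : nat) (Phi Pi : set 'rV[R]_n) (theta : 'rV[R]_n)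
    (C : set (set 'rV[R]_(n + 1))) :
  finite_root_system Phi -> root_base Phi Pi -> highest_root Phi Pi theta ->
  maximal_biclosed_chain (pos_roots (affine_roots Phi) (affine_base Pi theta)) C ->
  chain_is_initial_segments_of_unique_order
    (pos_roots (affine_roots Phi) (affine_base Pi theta)) C.
Proof.
move=> rs base [ptheta htheta]; have [f [lf f_ge0 fPhi]] := base_height _ _ rs base.
(* Apply maximality of [theta] to [- theta] and halve. *)
have span_theta : spanp Pi theta.
  have := spanpZ Pi 2^-1 _ _ (htheta _ (finite_rootN _ _ _ rs _ ptheta)); rewrite opprK.
  rewrite -mulr2n -scaler_nat scalerA mulVf ?scale1r ?pnatr_eq0//; apply.
  by rewrite invr_ge0.
have [t ft] : exists t : nat, f theta = t.+1%:R.
  have [t [[-> _]|ft]] := fPhi _ ptheta; first by exists t.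
  by have := f_ge0 _ span_theta; rewrite ft oppr_ge0 lern0.
have f_le a : Phi a -> f a <= t.+1%:R.
  by move=> /htheta/f_ge0; rewrite lin_formD// lin_formN// ft subr_ge0.
(* Here [delta] gets height [f theta + 1]. This gives [delta - theta] height 1 and exceeds every
   [f a] in absolute value, so that a root with nonzero level has the sign of its level. *)
pose h (v : 'rV[R]_(n + 1)) := f (lsubmx v) + t.+2%:R * v 0 (rshift n 0).
have hE a k : h (affv a k) = f a + t.+2%:R * k.
  by rewrite /h affv_proj /affv row_mxEr mxE.
have lh : lin_form h.
  by move=> c x y; rewrite /h linearP lf !mxE; ring.
have hroot a (k : int) : Phi a -> exists m : nat,
    (h (affv a k%:~R) = m.+1%:R /\ (0 < k \/ k = 0 /\ spanp Pi a)) \/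
    h (affv a k%:~R) = - m.+1%:R.
  move=> pa; have [j [fj j0 jt jpos]] : exists j : int, [/\ f a = j%:~R, j != 0,
      (`|j| <= t.+1)%N & 0 < j -> spanp Pi a].
    have [m [[fa spa]|fa]] := fPhi _ pa.
      by exists m.+1%:Z; split=> //; have := f_le _ pa; rewrite fa ler_nat.
    exists (- m.+1%:Z); split=> //.
    have := f_le _ (finite_rootN _ _ _ rs _ pa).
    by rewrite lin_formN// fa opprK ler_nat abszN.
  have -> : h (affv a k%:~R) = (j + t.+2%:Z * k)%:~R.
    by rewrite hE fj rmorphD rmorphM.
  have [k0|k0|k0] := ltgtP k 0.
  - have [m ->] : exists m : nat, j + t.+2%:Z * k = - m.+1%:Z.
      by exists (absz (j + t.+2%:Z * k)%R).-1; nia.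
    by exists m; right; rewrite rmorphN.
  - have [m ->] : exists m : nat, j + t.+2%:Z * k = m.+1%:Z.
      by exists (absz (j + t.+2%:Z * k)%R).-1; nia.
    by exists m; left; split=> //; left.
  rewrite k0 mulr0 addr0; case: j j0 jpos {fj jt} => [[|m]|m] // _ jpos; exists m; last by right.
  by left; split=> //; right; split=> //; apply: jpos.
have rd := root_datum_affine_full _ _ _ rs.
have h_ge0 v : spanp (affine_base Pi theta) v -> 0 <= h v.
  apply: lin_form_spanp_ge0 => // _ [[a [Pia ->]]|->]; rewrite hE.
    by rewrite mulr0 addr0; apply/f_ge0/spanp_mem.
  by rewrite lin_formN// ft mulr1 addrC subr_ge0 ler_nat.
have lift a : spanp Pi a -> spanp (affine_base Pi theta) (affv a 0).
  move=> [s [sPi ->]]; exists [seq (p.1, affv p.2 0) | p <- s]; split.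
    by move=> _ /mapP[p /sPi[p0 Pp] ->]; split=> //; left; exists p.2.
  rewrite big_map /=; elim: s {sPi} => [|p s IH].
    by rewrite !big_nil /affv raddf0 row_mx0.
  rewrite !big_cons -IH -[affv (\sum_(_ <- s) _) 0]scale1r affv_lin.
  by rewrite scale1r !mulr0 addr0.
have -> : pos_roots (affine_roots Phi) (affine_base Pi theta) =
    [set v | affine_roots Phi v /\ 0 < h v].
  apply/seteqP; split=> _ [[a [k [pa ->]]] hv].
    split; first exact: affv_root.
    have [m [[hm _]|hm]] := hroot a k pa; first by rewrite hm ltr0n.
    by have := h_ge0 _ hv; rewrite hm oppr_ge0 lern0.
  split; first exact: affv_root.
  have [m [[_ [k0|[-> spa]]]|hm]] := hroot a k pa; last first.
  - by move: hv; rewrite hm oppr_gt0 ltrn0.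
  - exact: lift.
  (* For [k > 0], write [a + k delta = k (delta - theta) + (theta + a) + (k - 1) theta], where
     [theta + a] is a nonnegative combination by maximality of [theta] against [- a]. *)
  have -> : affv a k%:~R = k%:~R *: affv (- theta) 1 +
      1 *: affv ((theta - - a) + (k - 1)%:~R *: theta) 0.
    rewrite affv_lin scale1r mulr0 addr0 mulr1; congr affv.
    by apply/rowP=> i; rewrite !mxE rmorphB; ring.
  rewrite scale1r; apply: spanpD.
    by apply: spanpZ; [rewrite ler0z ltW|apply: spanp_mem; right].
  apply/lift/spanpD; first by apply: htheta; apply: (finite_rootN _ _ _ rs).
  by apply: spanpZ => //; rewrite ler0z; lia.
apply: (affine_chain _ _ _ rs _ h).
- apply: positive_system_form => // [v|_ [a [k [pa ->]]]].
    exact: (rootN _ _ _ (lsubmx : {linear _ -> _}) _ _ rs rd).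
  by have [m [[-> _]|->]] := hroot a k pa => /eqP; rewrite ?oppr_eq0 pnatr_eq0.
- split=> // [v /= v0|_ [[a [k [pa ->]]]]].
    rewrite /h v0 lin_form0// add0r => /eqP; rewrite mulf_eq0 pnatr_eq0 /= => /eqP r0.
    rewrite -[v]hsubmxK v0; have -> : rsubmx v = 0; last exact: row_mx0.
    by apply/rowP=> i; rewrite ord1 !mxE.
  have [m [[-> _]|->]] := hroot a k pa; first by exists m.
  by rewrite oppr_gt0 ltrn0.
- move=> a r [[b [k [pb e]]]]; rewrite e.
  have -> : r = k%:~R.
    by move/(congr1 (fun v => rsubmx v 0 0)): e; rewrite /affv !row_mxKr !mxE !mulr1n.
  have [m [[_ [k0 _|[-> _] _]]|->]] := hroot b k pb.
  + by rewrite ler0z ltW.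
  + by [].
  + by rewrite oppr_gt0 ltrn0.
Qed.

Theorem theoremD :
  (* finite crystallographic root systems *)
  (forall (R : realType) (n : nat) (Phi Pi : set 'rV[R]_n) (C : set (set 'rV[R]_n)),
      finite_root_system Phi -> root_base Phi Pi ->
      maximal_biclosed_chain (pos_roots Phi Pi) C ->
      chain_is_initial_segments_of_unique_order (pos_roots Phi Pi) C) /\
  (* untwisted affine root systems *)
  (forall (R : realType) (n : nat) (Phi0 Pi0 : set 'rV[R]_n) (theta : 'rV[R]_n)
          (C : set (set 'rV[R]_(n + 1))),
      finite_root_system Phi0 -> irreducible_rs Phi0 -> root_base Phi0 Pi0 ->
      highest_root Phi0 Pi0 theta ->
      maximal_biclosed_chain (pos_roots (affine_roots Phi0) (affine_base Pi0 theta)) C ->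
      chain_is_initial_segments_of_unique_order
        (pos_roots (affine_roots Phi0) (affine_base Pi0 theta)) C).
Proof.
by split=> [|R n Phi0 Pi0 theta C rs _]; [exact: finite_case|exact: affine_case].
Qed.
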